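(* Let $\mathcal{X}_N=\{\mathbf{x}_1,\dots,\mathbf{x}_N\}$ be an $\varepsilon_0$-net of $\mathcal{X}$ and let the base points $\mathcal{B}_m=\{\mathbf{b}_1,\dots,\mathbf{b}_m\}$ be sampled independently according to a probability measure $\mu$ on $\mathcal{X}$ with $$m\geq\frac{1}{2\delta^2}\left(\#(\mathscr{M})\ln2-\ln p\right),$$ where $p,\delta\in(0,1)$. Consider the objective $f_{L,m}$ (defined in the context) for a certain choice of $L>0$ for which $$\Vert\mathbf{g}(\mathbf{b}_i)-\mathbf{g}(\mathbf{x}_j)\Vert_2\leq L\Vert\mathbf{m}_{\mathscr{M}}(\mathbf{b}_i)-\mathbf{m}_{\mathscr{M}}(\mathbf{x}_j)\Vert_2$$ is achieved for all $\mathbf{b}_i\in\mathcal{B}_m$, $\mathbf{x}_j\in\mathcal{X}_N$. Suppose also that $\mathbf{g}$ and the measurement functions $\mathbf{m}_k$, $k\in\mathscr{M}$, are all Lipschitz functions over $\mathcal{X}$. If $f_{L,m}(\mathscr{S})=f_{L,m}(\mathscr{M})$, where $\mathscr{S}\subseteq\mathscr{M}$, then the $\mu$-measure of points $\mathbf{x}\in\mathcal{X}$ such that $$\Vert\mathbf{g}(\mathbf{x})-\mathbf{g}(\mathbf{x}')\Vert_2<L\Vert\mathbf{m}_{\mathscr{S}}(\mathbf{x})-\mathbf{m}_{\mathscr{S}}(\mathbf{x}')\Vert_2+\left(\Vert\mathbf{g}\Vert_{\mathrm{lip}}+L\Vert\mathbf{m}_{\mathscr{S}}\Vert_{\mathrm{lip}}\right)\varepsilon_0$$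 for every $\mathbf{x}'\in\mathcal{X}$ is at least $1-\delta$ with probability at least $1-p$.
   Context: $\mathcal{X}\subset\mathbb{R}^n$; $\mathscr{M}$ is a finite set of sensors; $\mathbf{g}:\mathcal{X}\to\mathbb{R}^q$ is the target function and $\mathbf{m}_j:\mathcal{X}\to\mathbb{R}^{d_j}$, $j\in\mathscr{M}$, are the measurement functions. $\#(\cdot)$ denotes cardinality. For $\mathscr{S}\subseteq\mathscr{M}$, $\mathbf{m}_{\mathscr{S}}=(\mathbf{m}_j)_{j\in\mathscr{S}}$ is the concatenated measurement. An $\varepsilon_0$-net of $\mathcal{X}$ is a finite subset $\mathcal{X}_N\subset\mathcal{X}$ such that for every $\mathbf{x}\in\mathcal{X}$ there is $\mathbf{x}_i\in\mathcal{X}_N$ with $\Vert\mathbf{x}-\mathbf{x}_i\Vert_2<\varepsilon_0$. $\Vert\cdot\Vert_{\mathrm{lip}}$ denotes the Lipschitz constant over $\mathcal{X}$ with respect to Euclidean norms. The probability is over the random choice of base points. The sampled objective is $$f_{L,m}(\mathscr{S})=\sum_{\substack{1\leq i\leq m,\ 1\leq j\leq N,\\ \mathbf{g}(\mathbf{b}_i)\neq\mathbf{g}(\mathbf{x}_j)}}\min\left\{\frac{\Vert\mathbf{m}_{\mathscr{S}}(\mathbf{b}_i)-\mathbf{m}_{\mathscr{S}}(\mathbf{x}_j)\Vert_2^2}{\Vert\mathbf{g}(\mathbf{b}_i)-\mathbf{g}(\mathbf{x}_j)\Vert_2^2},\ \frac{1}{L^2}\right\}.$$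
   Formalization: Added the hypothesis that the sum of the Lipschitz constant of g and L times that of m_S is positive; if g and m_S are both constant, the strict inequality reads 0 < 0 and the claim fails. *)

(* Defs.v *)
From HB Require Import structures.
From mathcomp Require Import all_boot all_order all_algebra.
From mathcomp Require Import all_classical all_reals all_analysis.

Set Implicit Arguments.
Unset Strict Implicit.
Unset Printing Implicit Defensive.

Import Order.TTheory GRing.Theory Num.Theory.
Import numFieldTopology.Exports.

Local Open Scope classical_set_scope.
Local Open Scope ring_scope.

(* The norm of the library on matrices is the sup norm. *)
Definition norm2 (R : realType) (n : nat) (v : 'rV[R]_n) : R :=
  Num.sqrt (\sum_(i < n) v ord0 i ^+ 2).

(* The library requires measurable types to be pointed, hence the point x0.
   It plays no other role, and exists as soon as X carries a probability. *)
Definition borel_carrier (R : realType) (n : nat) (X : set 'rV[R]_n) (x0 : X) :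
  Type := X.

HB.instance Definition _ (R : realType) (n : nat) (X : set 'rV[R]_n) (x0 : X) :=
  Choice.on (borel_carrier x0).
HB.instance Definition _ (R : realType) (n : nat) (X : set 'rV[R]_n) (x0 : X) :=
  isPointed.Build (borel_carrier x0) x0.

(* X with the Borel sigma-algebra of its subspace topology; X itself need not
   be a Borel subset of R^n.  The topology of the library on 'rV[R]_n is the
   Euclidean one. *)
Definition borel_type (R : realType) (n : nat) (X : set 'rV[R]_n) (x0 : X) :=
  g_sigma_algebraType ((@open X) : set (set (borel_carrier x0))).

Section Functions.
Variables (R : realType) (n : nat) (X : set 'rV[R]_n).

Definition lipschitz2 (q : nat) (f : X -> 'rV[R]_q) : Prop :=
  exists K : R, forall x y : X,
    norm2 (f x - f y) <= K * norm2 (val x - val y).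

(* When X has at most one point this is sup set0 = 0. *)
Definition lip_const (q : nat) (f : X -> 'rV[R]_q) : R :=
  sup [set r | exists x y : X,
    x != y /\ r = norm2 (f x - f y) / norm2 (val x - val y)].

Definition eps_net (eps : R) (A : set X) : Prop :=
  finite_set A /\
  forall x : X, exists2 a : X, A a & norm2 (val x - val a) < eps.

Variables (M : finType) (d : M -> nat) (meas : forall j : M, X -> 'rV[R]_(d j)).

(* The sensors of S are concatenated in the order of the enumeration of S. *)
Definition concat_meas (S : {set M}) (x : X) :
    'rV[R]_(\sum_(k < #|S|) d (enum_val k)) :=
  \mxrow_(k < #|S|) meas (enum_val k) x.

Variables (q : nat) (g : X -> 'rV[R]_q).

Definition sampled_objective (m N : nat) (b : 'I_m -> X) (xs : 'I_N -> X)
    (L : R) (S : {set M}) : R :=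
  \sum_(i < m) \sum_(j < N | g (b i) != g (xs j))
    Num.min (norm2 (concat_meas S (b i) - concat_meas S (xs j)) ^+ 2 /
             norm2 (g (b i) - g (xs j)) ^+ 2)
            (1 / L ^+ 2).

End Functions.

Section Probability.
Local Open Scope ereal_scope.

(* For sets that need not be measurable.  A lower bound on the inner measure
   of A is a lower bound on the measure of a measurable subset of A. *)
Definition inner_measure (dsp : measure_display) (T : measurableType dsp)
    (R : realType) (mu : set T -> \bar R) (A : set T) : \bar R :=
  ereal_sup [set mu B | B in [set B | measurable B /\ B `<=` A]].

Lemma inner_measureE (dsp : measure_display) (T : measurableType dsp)
    (R : realType) (mu : {measure set T -> \bar R}) (A : set T) :
  measurable A -> inner_measure mu A = mu A.
Proof.
move=> mA; apply/eqP; rewrite eq_le; apply/andP; split.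
  apply: ge_ereal_sup => _ [B [mB BA] <-].
  by apply: le_measure => //; exact/mem_set.
by apply: ereal_sup_ubound; exists A => //; split.
Qed.

Definition mutually_independent (dsp dsp' : measure_display)
    (Omega : measurableType dsp) (T : measurableType dsp') (R : realType)
    (P : probability Omega R) (I : finType) (Y : I -> {RV P >-> T}) : Prop :=
  forall (J : {set I}) (A : I -> set T),
    (forall i, i \in J -> measurable (A i)) ->
    P (\bigcap_(i in [set` J]) (Y i @^-1` A i)) =
    \prod_(i in J) P (Y i @^-1` A i).

Definition iid_sample (dsp dsp' : measure_display)
    (Omega : measurableType dsp) (T : measurableType dsp') (R : realType)
    (P : probability Omega R) (mu : probability T R) (m : nat)
    (b : 'I_m -> {RV P >-> T}) : Prop :=
  mutually_independent b /\
  forall (i : 'I_m) (A : set T), measurable A -> distribution P (b i) A = mu A.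

End Probability.

(* Main.v *)
Require Import Defs.
From HB Require Import structures.
From mathcomp Require Import all_boot all_order all_algebra.
From mathcomp Require Import all_classical all_reals all_analysis.
From mathcomp Require Import ring lra.

Set Implicit Arguments.
Unset Strict Implicit.
Unset Printing Implicit Defensive.

Import Order.TTheory GRing.Theory Num.Theory.
Import numFieldTopology.Exports.

Local Open Scope classical_set_scope.
Local Open Scope ring_scope.

(** Fix a set of sensors S and call a point x good at level L when
    |g x - g x_j| <= L |m_S x - m_S x_j| for every point x_j of the net.

    Two deterministic facts reduce the theorem to the good set [fits S L].
    Every summand of the objective for S is at most the corresponding one for
    the full set of sensors, and the latter equals 1/L^2 by the choice of L; so
    equality of the two objectives forces every base point to be good
    ([fits_of_objective_eq]). Conversely, at a good point the net condition and
    the Lipschitz constants give the desired inequality against every x'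
    ([fits_of_net]).

    It remains to exclude, with probability 1 - p, that for some S and L all
    base points lie in a good set of measure less than 1 - delta. For fixed S
    and L this has probability at most (1 - delta)^m, which is at most
    exp (- 2 delta^2 m) ([onem_le_expR_sqr]). The level L may depend on the
    sample, so uncountably many events have to be controlled at once. The good
    sets increase with L, and the union of all those of measure less than
    1 - delta is contained in a single measurable set U_S of measure at most
    1 - delta ([chain_small_cover]). Hence the bad event for S lies in the event
    that all base points fall in U_S, whatever L is, and the bound on m is what
    a union bound over the 2^#|M| sets S needs
    ([union_bound_of_sample_size]).

    The good sets are Borel in X, since they are defined by finitely many
    inequalities between Lipschitz functions ([measurable_fits]). *)

(** * The Euclidean norm *)

Lemma norm2_ge0 (R : realType) (n : nat) (v : 'rV[R]_n) : 0 <= norm2 v.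
Proof. exact: sqrtr_ge0. Qed.

Lemma norm2_sqr (R : realType) (n : nat) (v : 'rV[R]_n) :
  norm2 v ^+ 2 = \sum_(i < n) v ord0 i ^+ 2.
Proof. by rewrite sqr_sqrtr//; apply: sumr_ge0 => i _; exact: sqr_ge0. Qed.

Lemma norm2N (R : realType) (n : nat) (v : 'rV[R]_n) : norm2 (- v) = norm2 v.
Proof. by congr Num.sqrt; apply: eq_bigr => i _; rewrite mxE sqrrN. Qed.

Lemma norm2_eq0 (R : realType) (n : nat) (v : 'rV[R]_n) :
  (norm2 v == 0) = (v == 0).
Proof.
rewrite -sqrf_eq0 norm2_sqr psumr_eq0; last by move=> i _; exact: sqr_ge0.
apply/allP/eqP => [v0|-> i _]; last by rewrite mxE expr0n /= eqxx.
apply/rowP => i; rewrite mxE; apply/eqP.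
rewrite -sqrf_eq0; exact: (implyP (v0 i (mem_index_enum i))).
Qed.

(** With a = |u| and c = |v|, expanding the sum of the (c u_i - a v_i)^2, which
    is nonnegative, gives 2 a c (a c - <u, v>): this is the Cauchy-Schwarz
    inequality. *)
Lemma norm2_triangle (R : realType) (n : nat) (u v : 'rV[R]_n) :
  norm2 (u + v) <= norm2 u + norm2 v.
Proof.
have [u0|u0] := eqVneq (norm2 u) 0.
  move/eqP: (u0); rewrite norm2_eq0 => /eqP ->.
  by rewrite !add0r lerDr norm2_ge0.
have [v0|v0] := eqVneq (norm2 v) 0.
  move/eqP: (v0); rewrite norm2_eq0 => /eqP ->.
  by rewrite !addr0 lerDl norm2_ge0.
set a := norm2 u in u0 *; set c := norm2 v in v0 *.
have a0 : 0 < a by rewrite lt_neqAle eq_sym u0 norm2_ge0.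
have c0 : 0 < c by rewrite lt_neqAle eq_sym v0 norm2_ge0.
rewrite -(@ler_pXn2r _ 2)// ?nnegrE ?norm2_ge0 ?addr_ge0 ?norm2_ge0//.
have cs : 0 <= \sum_(i < n) (c * u ord0 i - a * v ord0 i) ^+ 2.
  by apply: sumr_ge0 => i _; exact: sqr_ge0.
rewrite norm2_sqr; under eq_bigr do rewrite mxE sqrrD.
rewrite !big_split/= -!norm2_sqr -/a -/c sqrrD lerD2r lerD2l.
rewrite -mulr2n lerMn2r//=.
set s := \sum_(i < n) _.
suff E : \sum_(i < n) (c * u ord0 i - a * v ord0 i) ^+ 2 =
    a * c * (a * c - s) *+ 2.
  by move: cs; rewrite E pmulrn_lge0// pmulr_rge0 ?mulr_gt0// subr_ge0.
transitivity (c ^+ 2 * a ^+ 2 - (a * c * s) *+ 2 + a ^+ 2 * c ^+ 2);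
  last by ring.
rewrite [in X in X - _](norm2_sqr u) [in X in _ + X](norm2_sqr v) !mulr_sumr.
rewrite -sumrMnl -sumrB -big_split/=.
by apply: eq_bigr => i _; ring.
Qed.

Lemma norm2_dist (R : realType) (q : nat) (u v : 'rV[R]_q) :
  `|norm2 u - norm2 v| <= norm2 (u - v).
Proof.
have := norm2_triangle (u - v) v; have := norm2_triangle (v - u) u.
rewrite -(norm2N (v - u)) opprB !subrK ler_norml => h1 h2.
by apply/andP; split; lra.
Qed.

(** The comparison with the sup norm, which defines the topology of 'rV[R]_n. *)
Lemma norm2_le_coords (R : realType) (n : nat) (u : 'rV[R]_n) (e : R) :
  0 <= e -> (forall i, `|u ord0 i| <= e) -> norm2 u <= Num.sqrt n%:R * e.
Proof.
move=> e0 ue.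
rewrite -(@ler_pXn2r _ 2)// ?nnegrE ?mulr_ge0 ?norm2_ge0 ?sqrtr_ge0//.
rewrite exprMn [X in _ <= X * _]sqr_sqrtr// norm2_sqr.
rewrite mulr_natl -[in leRHS](card_ord n) -sumr_const.
by apply: ler_sum => i _; rewrite -real_normK ?num_real// lerXn2r// nnegrE.
Qed.

(** The square of the norm as a matrix product, the form in which it splits
    along the blocks of a concatenated vector. *)
Lemma norm2_sqr_mulmx (R : realType) (n : nat) (v : 'rV[R]_n) :
  norm2 v ^+ 2 = (v *m v^T) ord0 ord0.
Proof. by rewrite norm2_sqr mxE; apply: eq_bigr => i _; rewrite mxE expr2. Qed.

(** * Concatenated measurements *)

Section Concat.
Variables (R : realType) (n : nat) (X : set 'rV[R]_n).
Variables (M : finType) (d : M -> nat) (meas : forall j : M, X -> 'rV[R]_(d j)).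

Lemma norm2_concat_meas_sqr (S : {set M}) (x y : X) :
  norm2 (concat_meas meas S x - concat_meas meas S y) ^+ 2 =
  \sum_(j in S) norm2 (meas j x - meas j y) ^+ 2.
Proof.
rewrite /concat_meas -mxrowB norm2_sqr_mulmx tr_mxrow mul_mxrow_mxcol summxE.
by rewrite [RHS]big_enum_val; apply: eq_bigr => k _; rewrite norm2_sqr_mulmx.
Qed.

Lemma norm2_concat_meas_le (S T : {set M}) (x y : X) : S \subset T ->
  norm2 (concat_meas meas S x - concat_meas meas S y) <=
  norm2 (concat_meas meas T x - concat_meas meas T y).
Proof.
move=> ST; rewrite -(@ler_pXn2r _ 2)// ?nnegrE ?norm2_ge0//.
rewrite !norm2_concat_meas_sqr.
rewrite [leRHS](finset.big_setID S) (finset.setIidPr ST) lerDl.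
by apply: sumr_ge0 => i _; exact: sqr_ge0.
Qed.

Lemma lipschitz2_concat_meas (S : {set M}) :
  (forall j, lipschitz2 (@meas j)) -> lipschitz2 (concat_meas meas S).
Proof.
move=> /(_ _)/cid - H.
exists (Num.sqrt (\sum_(j in S) (projT1 (H j)) ^+ 2)) => x y.
rewrite -(@ler_pXn2r _ 2)// ?nnegrE ?mulr_ge0 ?norm2_ge0 ?sqrtr_ge0//.
rewrite exprMn [X in _ <= X * _]sqr_sqrtr; last first.
  by apply: sumr_ge0 => i _; exact: sqr_ge0.
rewrite norm2_concat_meas_sqr mulr_suml; apply: ler_sum => j _.
case: (H j) => K /= /(_ x y) HK.
by rewrite -exprMn lerXn2r// nnegrE ?(le_trans _ HK)// norm2_ge0.
Qed.

End Concat.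

(** * Lipschitz functions *)

Section Lip.
Variables (R : realType) (n : nat) (X : set 'rV[R]_n).

(** The supremum of difference quotients is a Lipschitz constant, because any
    Lipschitz constant bounds the quotients. *)
Lemma norm2_sub_le_lip_const (q : nat) (f : X -> 'rV[R]_q) (x y : X) :
  lipschitz2 f -> norm2 (f x - f y) <= lip_const f * norm2 (val x - val y).
Proof.
move=> [K fK]; have [<-|xy] := eqVneq x y.
  have /eqP -> : norm2 (f x - f x) == 0 by rewrite norm2_eq0 subrr.
  have /eqP -> : norm2 (val x - val x) == 0 by rewrite norm2_eq0 subrr.
  by rewrite mulr0.
have pos (u v : X) : u != v -> 0 < norm2 (val u - val v).
  move=> uv; rewrite lt_neqAle norm2_ge0 eq_sym norm2_eq0 subr_eq0 andbT.
  by rewrite val_eqE.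
rewrite -ler_pdivrMr ?pos//; apply: ub_le_sup; last by exists x, y.
by exists K => _ [u [v [uv ->]]]; rewrite ler_pdivrMr ?pos.
Qed.

(** The estimate is in the Euclidean norm of the ambient space, while the
    neighbourhoods of X are traces of sup-norm balls. *)
Lemma lipschitz_continuous (K : R) (h : X -> R) :
  (forall x y : X, `|h x - h y| <= K * norm2 (val x - val y)) -> continuous h.
Proof.
move=> hK x; apply/(@cvgrPdist_lt _ _ _ (nbhs x) (@nbhs_filter X x)) => e e0.
pose C := Num.max K 0 * Num.sqrt n%:R + 1.
have C0 : 0 < C by rewrite ltr_wpDl// mulr_ge0 ?sqrtr_ge0// le_max lexx orbT.
have xe : \forall y \near x, ball (val x) (e / C) (val y).
  apply: (@initial_continuous _ _ (val : X -> 'rV[R]_n) x).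
  exact: nbhsx_ballx (divr_gt0 e0 C0).
move: xe; apply: (@filterS _ (nbhs x) (@nbhs_filter X x)) => y /= [_ xy].
apply: (le_lt_trans (hK x y)).
apply: (@le_lt_trans _ _ (Num.max K 0 * (Num.sqrt n%:R * (e / C)))).
  apply: (@le_trans _ _ (Num.max K 0 * norm2 (val x - val y))).
    by rewrite ler_wpM2r ?norm2_ge0// le_max lexx.
  rewrite ler_wpM2l ?le_max ?lexx ?orbT// norm2_le_coords ?divr_ge0 ?ltW//.
  by move=> i; rewrite !mxE ltW//; have := xy ord0 i; rewrite /ball/=.
rewrite !mulrA -[ltRHS](divfK (lt0r_neq0 C0)) [ltRHS]mulrAC.
rewrite ltr_pM2r ?invr_gt0//.
by rewrite [ltRHS]mulrC ltr_pM2r// /C ltrDl.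
Qed.

End Lip.

(** * An exponential bound for the failure probability *)

(** The function (1 - y) exp (2 y^2) equals 1 at 0 and has derivative
    - (1 - 2 y)^2 exp (2 y^2), so it never increases. This is the extreme case
    of Hoeffding's inequality, in which all the trials succeed. *)
Lemma onem_le_expR_sqr (R : realType) (x : R) :
  0 <= x -> 1 - x <= expR (- (2 * x ^+ 2)).
Proof.
move=> x0; rewrite expRN -[leRHS]mul1r ler_pdivlMr ?expR_gt0//.
pose f (y : R) := (1 - y) * expR (2 * y ^+ 2).
have df (y : R) : is_derive y 1 f (- ((1 - 2 * y) ^+ 2 * expR (2 * y ^+ 2))).
  apply: is_derive_eq; rewrite /GRing.scale/=; ring.
have f0 : f 0 = 1 by rewrite /f expr0n mulr0 expR0 subr0 mulr1.
rewrite -[leRHS]f0 -/(f x); apply: (@ler0_derive1_nincry _ f 0) => //.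
- move=> y _; rewrite derive1E derive_val oppr_le0.
  by rewrite mulr_ge0// ?sqr_ge0 ?expR_ge0.
- by apply: derivable_within_continuous => y _; case: (df y).
Qed.

(** The lower bound on the sample size, solved for [p]. *)
Lemma union_bound_of_sample_size (R : realType) (k m : nat) (p delta : R) :
  0 < p -> 0 < delta ->
  1 / (2 * delta ^+ 2) * (k%:R * ln 2 - ln p) <= m%:R ->
  expR (- (2 * delta ^+ 2)) ^+ m *+ 2 ^ k <= p.
Proof.
move=> p0 d0; have c0 : 0 < 2 * delta ^+ 2 by rewrite mulr_gt0// exprn_gt0.
rewrite mulrAC mul1r ler_pdivrMr// => mge.
have two : (2 ^ k)%:R = expR (k%:R * ln 2 : R).
  by rewrite expRM_natl lnK ?posrE// natrX.
rewrite -mulr_natr two -expRM_natl -expRD -[leRHS]lnK ?posrE// ler_expR; lra.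
Qed.

(** * Chains of sets, independence and the union bound *)

Section Chain.
Local Open Scope ereal_scope.

(** The union of all the sets F s of measure less than c works, if it is
    measurable and has measure at most c. If there is a largest such s, the
    union is F s. Otherwise between any admissible s and a larger admissible
    one there is a rational, which is admissible by monotonicity; so rational
    indices suffice, and finite unions of members of a chain are again members
    of the chain. *)
Lemma chain_small_cover (dsp : measure_display) (T : measurableType dsp)
    (R : realType) (mu : {measure set T -> \bar R}) (F : R -> set T) (c : R) :
  (0 <= c)%R -> (forall s, measurable (F s)) ->
  (forall s t, (s <= t)%R -> F s `<=` F t) ->
  exists U : set T, [/\ measurable U, mu U <= c%:E &
    forall s, mu (F s) < c%:E -> F s `<=` U].
Proof.
move=> c0 mF Fle.
have [[s [Fs smax]]|nomax] := pselect (exists s, mu (F s) < c%:E /\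
    forall t, mu (F t) < c%:E -> (t <= s)%R).
  by exists (F s); split => //; [exact: ltW | move=> t /smax; exact: Fle].
pose V k := if unpickle k is Some r then
  if mu (F (ratr (r : rat))) < c%:E then F (ratr r) else set0 else set0.
pose A k := \big[setU/set0]_(i < k) V i.
have VE k : V k = set0 \/ exists2 s, mu (F s) < c%:E & V k = F s.
  rewrite /V; case: (unpickle k) => [r|]; last by left.
  by case: ifPn => h; [right; exists (ratr r) | left].
have AE k : A k = set0 \/ exists2 s, mu (F s) < c%:E & A k = F s.
  rewrite /A; elim: k => [|k IH]; first by left; rewrite big_ord0.
  rewrite big_ord_recr/=.
  case: IH => [->|[s Fs ->]]; first by rewrite set0U.
  case: (VE k) => [->|[t Ft ->]]; first by right; exists s => //; rewrite setU0.
  right; case: (leP s t) => [st|/ltW ts].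
    by exists t => //; rewrite setUidr//; exact: Fle.
  by exists s => //; rewrite setUidl//; exact: Fle.
have mA k : measurable (A k) by case: (AE k) => [->|[s _ ->]].
exists (\bigcup_k A k); split; first exact: bigcup_measurable.
- have Acvg : mu \o A @ \oo --> mu (\bigcup_k A k).
    apply: nondecreasing_cvg_mu => //; first exact: bigcup_measurable.
    move=> k l kl; apply/subsetPset; exact: subset_bigsetU.
  rewrite -(cvg_lim _ Acvg)//; apply: lime_le.
    by apply/cvg_ex; eexists; exact: Acvg.
  apply: nearW => k /=.
  by case: (AE k) => [->|[s /ltW Fs ->]]; rewrite ?measure0 ?lee_fin.
- move=> s Fs x Fsx.
  have [t [st Ft]] : exists t, (s < t)%R /\ mu (F t) < c%:E.
    apply: contrapT => not_t; apply: nomax; exists s; split => // t Ft.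
    by rewrite leNgt; apply/negP => st; apply: not_t; exists t.
  have [r /[!in_itv]/= /andP[sr rt]] := rat_in_itvoo st.
  (* The rational lies below the admissible index t, so it is admissible too. *)
  have Fr : mu (F (ratr r)) < c%:E.
    apply: le_lt_trans Ft; apply: le_measure; rewrite ?inE//.
    by apply: Fle; exact: ltW.
  exists (pickle r).+1 => //; rewrite /A big_ord_recr/=; right.
  by rewrite /V pickleK Fr; apply: (Fle s) => //; exact: ltW.
Qed.

Lemma iid_sample_all_in (dsp dsp' : measure_display)
    (Omega : measurableType dsp) (T : measurableType dsp') (R : realType)
    (P : probability Omega R) (mu : probability T R) (m : nat)
    (b : 'I_m -> {RV P >-> T}) (U : set T) (c : R) :
  iid_sample mu b -> measurable U -> mu U <= c%:E ->
  P (\bigcap_(i in setT) (b i @^-1` U)) <= (c ^+ m)%:E.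
Proof.
move=> [indep dist] mU Uc.
have := indep [set: 'I_m]%SET (fun=> U) (fun _ _ => mU).
rewrite (_ : [set` _] = setT); last first.
  by apply/seteqP; split => // i _ /=; rewrite finset.in_setT.
move=> ->.
have U_fin : mu U = (fine (mu U))%:E by rewrite fineK// fin_num_measure.
rewrite (eq_bigr (fun=> (fine (mu U))%:E)); last first.
  by move=> i _; rewrite -[LHS]/(distribution P (b i) U) dist.
rewrite prodEFin prodr_const cardsT card_ord lee_fin lerXn2r ?nnegrE//.
- by rewrite fine_ge0.
- by rewrite -lee_fin (le_trans _ Uc).
- by rewrite -lee_fin -U_fin.
Qed.

Lemma le_inner_measure (dsp : measure_display) (T : measurableType dsp)
    (R : realType) (mu : set T -> \bar R) (A B : set T) :
  measurable B -> B `<=` A -> mu B <= inner_measure mu A.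
Proof. by move=> mB BA; apply: ereal_sup_ubound; exists B. Qed.

Lemma measure_bigcup_finType_le (dsp : measure_display) (T : measurableType dsp)
    (R : realType) (mu : {measure set T -> \bar R}) (I : finType)
    (A : I -> set T) (c : R) :
  (forall i, measurable (A i)) -> (forall i, mu (A i) <= c%:E) ->
  mu (\bigcup_(i in setT) A i) <= (c *+ #|I|)%:E.
Proof.
move=> mA Ac.
have enumT' : [set: I] = [set` enum I].
  by apply/seteqP; split => // i _ /=; rewrite mem_enum.
rewrite enumT'.
apply: (@le_trans _ _ (\sum_(i \in [set` enum I]) mu (A i))).
  apply: content_sub_fsum => //.
  by apply: fin_bigcup_measurable.
rewrite -fsbig_seq ?enum_uniq// big_enum/=.
by apply: (le_trans (lee_sum _ (fun i _ => Ac i))); rewrite sumEFin sumr_const.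
Qed.

End Chain.

(** * Points that fit the net *)

Section Fits.
Variables (R : realType) (n : nat) (X : set 'rV[R]_n) (x0 : X).
Variables (M : finType) (d : M -> nat) (meas : forall j : M, X -> 'rV[R]_(d j)).
Variables (q : nat) (g : X -> 'rV[R]_q) (N : nat) (xs : 'I_N -> X).
Hypotheses (glip : lipschitz2 g) (measlip : forall j, lipschitz2 (@meas j)).

Definition fits (S : {set M}) (L : R) : set (borel_type x0) :=
  [set x : X | forall j, norm2 (g x - g (xs j)) <=
    L * norm2 (concat_meas meas S x - concat_meas meas S (xs j))].

(** The complement is open: it is a union of sets where a continuous function
    is positive. *)
Lemma measurable_fits (S : {set M}) (L : R) : measurable (fits S L).
Proof.
pose mS := concat_meas meas S.
pose h j (x : X) : R := norm2 (g x - g (xs j)) - L * norm2 (mS x - mS (xs j)).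
have hcont j : continuous (h j).
  apply: (@lipschitz_continuous _ _ _ (lip_const g + `|L| * lip_const mS)).
  move=> x y.
  have gE := norm2_sub_le_lip_const x y glip.
  have mE := norm2_sub_le_lip_const x y (lipschitz2_concat_meas S measlip).
  have gD := norm2_dist (g x - g (xs j)) (g y - g (xs j)).
  have mD := norm2_dist (mS x - mS (xs j)) (mS y - mS (xs j)).
  rewrite !opprB !addrA !subrK in gD mD.
  rewrite mulrDl -mulrA.
  rewrite (_ : h j x - h j y = (norm2 (g x - g (xs j)) - norm2 (g y - g (xs j)))
     - L * (norm2 (mS x - mS (xs j)) - norm2 (mS y - mS (xs j)))); last first.
    by rewrite /h; ring.
  apply: (le_trans (ler_normB _ _)); apply: lerD; first exact: le_trans gE.
  by rewrite normrM ler_wpM2l// (le_trans mD).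
rewrite (_ : fits S L = ~` (\bigcup_j (h j @^-1` [set r | 0 < r]))).
  apply: measurableC; apply: sub_sigma_algebra.
  apply: bigcup_open => j _; apply: open_comp; last exact: open_gt.
  by move=> x _; exact: hcont.
apply/seteqP; split => [x fx [j _ /=]|x nfx j].
  by rewrite /h subr_gt0 ltNge => /negP; apply; exact: fx.
by rewrite -subr_le0 leNgt; apply/negP => hx; apply: nfx; exists j.
Qed.

Lemma fits_le (S : {set M}) (s t : R) : s <= t -> fits S s `<=` fits S t.
Proof.
by move=> st x fx j; apply: le_trans (fx j) _; rewrite ler_wpM2r// norm2_ge0.
Qed.

(** Passing from x' to the nearest point of the net costs less than [eps] in
    distance, hence at most lip g * eps on the target side and at most
    L * lip m_S * eps on the measurement side. The positivity of the combined
    Lipschitz constant makes the conclusion strict. *)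
Lemma fits_of_net (eps L : R) (S : {set M}) (x : X) :
  0 < L -> eps_net eps (range xs) ->
  0 < lip_const g + L * lip_const (concat_meas meas S) ->
  fits S L x -> forall x' : X,
  norm2 (g x - g x') <
    L * norm2 (concat_meas meas S x - concat_meas meas S x') +
    (lip_const g + L * lip_const (concat_meas meas S)) * eps.
Proof.
move=> L0 [_ net] lip0 fx x'; have [_ [j _ <-] xj] := net x'.
set mS := concat_meas meas S in lip0 *.
have gE := norm2_sub_le_lip_const x' (xs j) glip.
have mE := norm2_sub_le_lip_const x' (xs j) (lipschitz2_concat_meas S measlip).
have gT := norm2_triangle (g x - g (xs j)) (g (xs j) - g x').
have mT := norm2_triangle (mS x - mS x') (mS x' - mS (xs j)).
rewrite -(norm2N (g (xs j) - g x')) opprB in gT.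
rewrite !addrA !subrK in gT mT.
apply: (@le_lt_trans _ _ (L * norm2 (mS x - mS x') +
   (lip_const g + L * lip_const mS) * norm2 (val x' - val (xs j)))).
  apply: (le_trans gT); apply: (le_trans (lerD (fx j) gE)).
  have := ler_wpM2l (ltW L0) (le_trans mT (lerD (lexx _) mE)).
  by rewrite mulrDr mulrA mulrDl addrA => ?; rewrite [leRHS]addrAC lerD2r.
by rewrite ltrD2l ltr_pM2l.
Qed.

(** Dropping sensors can only decrease each truncated quotient, so equal sums
    have equal terms. For the full set of sensors every term is 1/L^2; thus no
    quotient for S is below 1/L^2, which is the inequality defining [fits]. *)
Lemma fits_of_objective_eq (m : nat) (b : 'I_m -> X) (L : R) (S : {set M}) :
  0 < L ->
  (forall i j, norm2 (g (b i) - g (xs j)) <=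
     L * norm2 (concat_meas meas [set: M] (b i) -
                concat_meas meas [set: M] (xs j))) ->
  sampled_objective meas g b xs L S =
    sampled_objective meas g b xs L [set: M] ->
  forall i, fits S L (b i).
Proof.
move=> L0 fitM objE i j.
have [->|gij] := eqVneq (g (b i)) (g (xs j)).
  rewrite subrr (_ : norm2 0 = 0) ?mulr_ge0 ?norm2_ge0 ?ltW//.
  by apply/eqP; rewrite norm2_eq0.
(* A term of the objective for the set of sensors T. *)
pose t T i j := Num.min (norm2 (concat_meas meas T (b i) -
  concat_meas meas T (xs j)) ^+ 2 / norm2 (g (b i) - g (xs j)) ^+ 2)
  (1 / L ^+ 2).
have tle i' j' : t S i' j' <= t [set: M]%SET i' j'.
  rewrite /t le_min !ge_min lexx orbT andbT; apply/orP; left.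
  rewrite ler_wpM2r ?invr_ge0 ?sqr_ge0// lerXn2r ?nnegrE ?norm2_ge0//.
  exact: norm2_concat_meas_le (finset.subsetT S).
have tE : t S i j = t [set: M]%SET i j.
  apply/esym/eqP; rewrite -subr_eq0; apply/eqP.
  have t0 i' j' : 0 <= t [set: M]%SET i' j' - t S i' j' by rewrite subr_ge0.
  have sum0 : \sum_(i' < m) \sum_(j' < N | g (b i') != g (xs j'))
      (t [set: M]%SET i' j' - t S i' j') = 0.
    rewrite (eq_bigr _ (fun i' _ => sumrB _ _ _ _)) sumrB.
    by apply/eqP; rewrite subr_eq0; apply/eqP/esym.
  have sumi0 := psumr_eq0P (fun i' _ => sumr_ge0 _ (fun j' _ => t0 i' j')) sum0.
  exact: (psumr_eq0P (fun j' _ => t0 i j') (sumi0 i isT)).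
have g0 : 0 < norm2 (g (b i) - g (xs j)).
  by rewrite lt_neqAle norm2_ge0 eq_sym norm2_eq0 subr_eq0 gij.
have : 1 / L ^+ 2 <= t S i j.
  rewrite tE /t le_min lexx andbT ler_pdivlMr ?exprn_gt0// mulrC mulrA mulr1.
  rewrite ler_pdivrMr ?exprn_gt0// mulrC -exprMn lerXn2r ?nnegrE ?norm2_ge0//.
  by rewrite mulr_ge0 ?norm2_ge0 ?ltW.
rewrite /t le_min lexx andbT ler_pdivlMr ?exprn_gt0// mulrC mulrA mulr1.
rewrite ler_pdivrMr ?exprn_gt0// mulrC -exprMn.
by rewrite ler_pXn2r// nnegrE ?norm2_ge0// mulr_ge0 ?norm2_ge0// ltW.
Qed.

End Fits.

Arguments fits {R n X} x0 {M d} meas {q} g {N} xs S L.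

(** * Recovery from finitely many base points *)

Theorem theorem5p5 (R : realType) (n : nat) (X : set 'rV[R]_n) (x0 : X)
  (M : finType) (q : nat) (g : X -> 'rV[R]_q)
  (d : M -> nat) (meas : forall j : M, X -> 'rV[R]_(d j))
  (glip : lipschitz2 g) (measlip : forall j : M, lipschitz2 (@meas j))
  (eps0 : R) (N : nat) (xs : 'I_N -> X) (net : eps_net eps0 (range xs))
  (p delta : R) (p01 : 0 < p < 1) (delta01 : 0 < delta < 1)
  (mu : probability (borel_type x0) R)
  (dsp : measure_display) (Omega : measurableType dsp)
  (P : probability Omega R)
  (m : nat) (b : 'I_m -> {RV P >-> borel_type x0}) (biid : iid_sample mu b)
  (mge : 1 / (2 * delta ^+ 2) * (#|M|%:R * ln 2 - ln p) <= m%:R) :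
  ((1 - p)%:E <= inner_measure P
    [set w : Omega |
      (forall L : R, 0 < L ->
       (forall (i : 'I_m) (j : 'I_N),
         norm2 (g (b i w) - g (xs j)) <=
         L * norm2 (concat_meas meas [set: M] (b i w) -
                    concat_meas meas [set: M] (xs j))) ->
       forall S : {set M},
       0 < lip_const g + L * lip_const (concat_meas meas S) ->
       sampled_objective meas g (fun i => b i w) xs L S =
       sampled_objective meas g (fun i => b i w) xs L [set: M] ->
       ((1 - delta)%:E <= inner_measure mu
         [set x : borel_type x0 |
           (forall x' : X,
             norm2 (g x - g x') <
             L * norm2 (concat_meas meas S x - concat_meas meas S x') +
             (lip_const g + L * lip_const (concat_meas meas S)) * eps0)%R])%E)%R
    ])%E.
Proof.
have /andP[p0 p1] := p01; have /andP[delta0 delta1] := delta01.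
have delta_ge0 : 0 <= 1 - delta by rewrite subr_ge0 ltW.
pose F S L := fits x0 meas g xs S L.
have mF S L : measurable (F S L) by exact: measurable_fits.
have /choice[U UP] (S : {set M}) := chain_small_cover mu delta_ge0 (mF S)
  (@fits_le _ _ _ x0 _ _ meas _ g _ xs S).
(* The event that the whole sample falls in the exceptional set of S. *)
pose A S := \bigcap_(i in [set: 'I_m]) (b i @^-1` U S).
have mA S : measurable (A S).
  apply: fin_bigcap_measurable => // i _; rewrite -[X in measurable X]setTI.
  by apply: (measurable_funPT (b i)) => //; case: (UP S).
have mBad : measurable (\bigcup_(S in [set: {set M}]) A S).
  by apply: fin_bigcup_measurable => // S _.
have PA S : (P (A S) <= (expR (- (2 * delta ^+ 2)) ^+ m)%:E)%E.
  have [mU muU _] := UP S.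
  apply: le_trans (iid_sample_all_in biid mU muU) _.
  by rewrite lee_fin lerXn2r ?nnegrE ?expR_ge0// onem_le_expR_sqr// ltW.
have PBad : (P (\bigcup_(S in [set: {set M}]) A S) <= p%:E)%E.
  apply: le_trans (measure_bigcup_finType_le mA PA) _; rewrite lee_fin.
  rewrite -cardsT -finset.powersetT card_powerset cardsT.
  exact: union_bound_of_sample_size.
apply: (@le_trans _ _ (P (~` \bigcup_(S in [set: {set M}]) A S))).
  rewrite probability_setC// EFinB; exact: leeB.
apply: le_inner_measure; first exact: measurableC.
move=> w nBad L L0 fitM S lip0 objE.
(* Outside the bad event, a good set that contains the whole sample cannot have
   measure less than 1 - delta. *)
have fitS := fits_of_objective_eq x0 L0 fitM objE.
have : ~ (mu (F S L) < (1 - delta)%:E)%E.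
  move=> FL; apply: nBad; exists S => // i _.
  by have [_ _ /(_ L FL)] := UP S; apply; exact: fitS.
move=> /negP; rewrite -leNgt => /le_trans; apply.
apply: le_inner_measure => // x; exact: fits_of_net.
Qed.
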